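(* Let $d\ge2$, let $\sigma_1,\dots,\sigma_d\in\mathbb{C}$ be distinct support points and $\xi_1,\dots,\xi_d\in\mathbb{C}$ nonzero weights, and let $$\phi_j(s)=\frac{\xi_j/(s-\sigma_j)}{\sum_{i=1}^d\xi_i/(s-\sigma_i)},\qquad j=1,\dots,d.$$ For a rational function $r(s)=\sum_{j=1}^d r(\sigma_j)\phi_j(s)$ consider the $d\times d$ pencil $$\begin{bmatrix} r(\sigma_d)&r(\sigma_1)-r(\sigma_d)&\cdots&\cdots&r(\sigma_{d-1})-r(\sigma_d)\\ 0&\xi_2(s-\sigma_1)&\xi_1(\sigma_2-s)&&\\ \vdots&&\ddots&\ddots&\\ 0&&&\xi_{d-1}(s-\sigma_{d-2})&\xi_{d-2}(\sigma_{d-1}-s)\\ \xi_{d-1}(\sigma_d-s)&\xi_{d-1}(s-\sigma_d)&\cdots&\xi_{d-1}(s-\sigma_d)&\xi_{d-1}(s-\sigma_d)+\xi_d(s-\sigma_{d-1}) \end{bmatrix}.$$ Then the last $d-1$ rows of this pencil form a full rank dual linear basis to $[1,\phi_1,\dots,\phi_{d-1}]^T$.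
   Context: In the displayed pencil, the $d-2$ rows between the first and last row are, for $j=1,\dots,d-2$, the rows with entry $\xi_{j+1}(s-\sigma_j)$ in column $j+1$, entry $\xi_j(\sigma_{j+1}-s)$ in column $j+2$, and zeros elsewhere. In the last row, the first entry is $\xi_{d-1}(\sigma_d-s)$, the entries in columns $2,\dots,d-1$ are $\xi_{d-1}(s-\sigma_d)$, and the entry in column $d$ is $\xi_{d-1}(s-\sigma_d)+\xi_d(s-\sigma_{d-1})$. A $(k-1)\times k$ pencil $M-sN$ is called a dual linear basis of a vector $\mathbf{\Phi}(s)\in\mathbb{C}^k$ of rational functions if $(M-sN)\mathbf{\Phi}(s)=0$ identically. It is a full rank dual linear basis if, in addition, $M-sN$ has full rank ($k-1$) for all $s\in\mathbb{C}\cup\{\infty\}$, where full rank at $s=\infty$ means that $N$ has full rank. *)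

(* Defs.v *)
From HB Require Import structures.
From mathcomp Require Import all_boot all_order all_algebra.
From mathcomp Require Import generic_quotient reals complex.

Set Implicit Arguments.
Unset Strict Implicit.
Unset Printing Implicit Defensive.

Import GRing.Theory.
Local Open Scope ring_scope.
Local Open Scope quotient_scope.

Notation ratfun F := {fraction {poly F}}.
Notation "p %:F" := (@FracField.tofrac _ p) (at level 1, format "p %:F").

(* The representative of a fraction need not be in lowest terms, so common
   factors are removed before evaluating.  The value at a pole is 0. *)
Definition rateval (F : fieldType) (r : ratfun F) (a : F) : F :=
  let n := \n_(repr r) in
  let d := \d_(repr r) in
  (n %/ gcdp n d).[a] / (d %/ gcdp n d).[a].

Lemma ratfun_repr (F : fieldType) (r : ratfun F) :
  r = (\n_(repr r))%:F / (\d_(repr r))%:F.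
Proof.
have dF0 : (\d_(repr r))%:F != 0 :> ratfun F.
  by rewrite tofrac_eq0 denom_ratioP.
apply: (mulIf dF0); rewrite divfK // -[X in X * _](reprK r).
move: (repr r) => x; rewrite -[LHS]/(FracField.mul _ _) !piE; apply/eqmodP.
rewrite /= FracField.equivfE /FracField.mulf.
by rewrite !numden_Ratio ?mulr1 ?oner_neq0 ?denom_ratioP // mulrC.
Qed.

Lemma ratevalE (F : fieldType) (p q : {poly F}) (a : F) :
  q.[a] != 0 -> rateval (p%:F / q%:F) a = p.[a] / q.[a].
Proof.
move=> qa0; have q0 : q != 0 by apply: contraNneq qa0 => ->; rewrite horner0.
rewrite /rateval; have := ratfun_repr (p%:F / q%:F).
move: (denom_ratioP (repr (p%:F / q%:F : ratfun F))).
move: (\n_(repr _)) (\d_(repr _)) => n d d0 /esym/eqP.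
rewrite eqr_div ?tofrac_eq0 // -!tofracM tofrac_eq => /eqP nq.
set g := gcdp n d; have g0 : g != 0 by rewrite gcdp_eq0 negb_and d0 orbT.
have nE : n %/ g * g = n by rewrite divpK ?dvdp_gcdl.
have dE : d %/ g * g = d by rewrite divpK ?dvdp_gcdr.
have nq' : n %/ g * q = p * (d %/ g).
  by apply: (mulIf g0); rewrite -mulrA [q * g]mulrC mulrA nE nq -mulrA dE.
have nqa : (n %/ g).[a] * q.[a] = p.[a] * (d %/ g).[a].
  by rewrite -!hornerM nq'.
have cop : coprimep (n %/ g) (d %/ g) by rewrite coprimep_div_gcd ?d0 ?orbT.
have da0 : (d %/ g).[a] != 0.
  apply/eqP => da0; move/eqP: nqa; rewrite da0 mulr0 mulf_eq0 (negPf qa0) orbF.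
  by move=> /(coprimep_root cop); rewrite da0 eqxx.
by apply/eqP; rewrite eqr_div // nqa.
Qed.

(* The j-th barycentric basis function, indexed from 0. *)
Definition baryc (F : fieldType) (d : nat) (sigma xi : d.-tuple F) (j : nat) :
    ratfun F :=
  let term i : ratfun F := (xi`_i)%:P%:F / ('X - (sigma`_i)%:P)%:F in
  term j / \sum_(i < d) term i.

Definition baryc_vec (F : fieldType) (d : nat) (sigma xi : d.-tuple F) :
    'cV[ratfun F]_d :=
  \col_(j < d) if j == 0%N :> nat then 1 else baryc sigma xi j.-1.

(* Rows, columns, support points and weights are all indexed from 0, so the
   last index is d.-1. *)
Definition baryc_pencil (F : fieldType) (d : nat) (sigma xi : d.-tuple F)
    (r : ratfun F) : 'M[{poly F}]_d :=
  let val j := rateval r sigma`_j in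
  \matrix_(i < d, j < d)
    if i == 0%N :> nat then
      if j == 0%N :> nat then (val d.-1)%:P
      else (val j.-1 - val d.-1)%:P
    else if i == d.-1 :> nat then
      if j == 0%N :> nat then xi`_d.-2 *: ((sigma`_d.-1)%:P - 'X)
      else if j == d.-1 :> nat then
        xi`_d.-2 *: ('X - (sigma`_d.-1)%:P) + xi`_d.-1 *: ('X - (sigma`_d.-2)%:P)
      else xi`_d.-2 *: ('X - (sigma`_d.-1)%:P)
    else
      if j == i :> nat then xi`_i *: ('X - (sigma`_i.-1)%:P)
      else if j == i.+1 :> nat then xi`_i.-1 *: ((sigma`_i)%:P - 'X)
      else 0.

(* M - s N, with s the polynomial variable. *)
Definition pencil (F : fieldType) (m n : nat) (M N : 'M[F]_(m, n)) :
    'M[{poly F}]_(m, n) :=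
  map_mx polyC M - 'X *: map_mx polyC N.

Definition dual_linear_basis (F : fieldType) (k : nat) (M N : 'M[F]_(k.-1, k))
    (Phi : 'cV[ratfun F]_k) : Prop :=
  map_mx (fun p : {poly F} => p%:F) (pencil M N) *m Phi = 0.

Definition full_rank_dual_linear_basis (F : fieldType) (k : nat)
    (M N : 'M[F]_(k.-1, k)) (Phi : 'cV[ratfun F]_k) : Prop :=
  [/\ dual_linear_basis M N Phi,
      forall s : F, \rank (M - s *: N) = k.-1 &
      \rank N = k.-1].

(* Main.v *)
(** Write [w_k = s - sigma_k] and let [phi_k] be the barycentric functions.
    Row [i] of the pencil encodes the identity
    [xi_(i+1) w_i phi_i = xi_i w_(i+1) phi_(i+1)], where [phi_(d-1)] is rewritten
    as [1 - phi_0 - ... - phi_(d-2)].  Hence the pencil factors as [B(w) E] with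
    [B(w)] bidiagonal and [E] constant and invertible.  If [u B(w) = 0] then
    [y_(k+1) = u_k xi_k xi_(k+1)], extended by zero at both ends, satisfies
    [w_k (y_(k+1) - y_k) = 0] for all [k].  At most one [w_k] vanishes, and the
    differences of [y] sum to zero, so all of them vanish and [u = 0].  At
    infinity the same argument applies to [w = -1]. *)
Require Import Defs.
From mathcomp Require Import all_boot all_order all_algebra.
From mathcomp Require Import reals complex.
From mathcomp Require Import ring.

Set Implicit Arguments.
Unset Strict Implicit.
Unset Printing Implicit Defensive.

Import GRing.Theory.
Local Open Scope ring_scope.

Section BidiagonalFactor.
Variables (A : comNzRingType) (n : nat).
Implicit Types (xi w : nat -> A).

(** Linear in [w], which stays free so that the polynomial pencil, its value at a point and both of
    its coefficients are instances. *)
Definition bidiag xi w : 'M[A]_(n.+1, n.+2) :=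
  \matrix_(i, k) (xi i.+1 * w i *+ (k == i :> nat)
                  - xi i * w i.+1 *+ (k == i.+1 :> nat)).

(* Sends [1, phi_0, ..., phi_n] to [phi_0, ..., phi_(n+1)] if the [phi_k] sum
   to 1. *)
Definition shift_unity : 'M[A]_n.+2 :=
  \matrix_(k, j) if k == n.+1 :> nat then (if j == 0 :> nat then 1 else -1)
                 else (j == k.+1 :> nat)%:R.

Lemma mul_bidiag m xi w (X : 'M[A]_(n.+2, m)) (i : 'I_n.+1) (j : 'I_m) :
  (bidiag xi w *m X) i j = xi i.+1 * w i * X (widen_ord (leqnSn _) i) j
                           - xi i * w i.+1 * X (lift ord0 i) j.
Proof.
rewrite mxE; under eq_bigr do rewrite mxE mulrBl.
rewrite sumrB; congr (_ - _).
  rewrite (bigD1 (widen_ord (leqnSn _) i)) //= eqxx big1 ?addr0 // => k.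
  by rewrite -val_eqE /= => /negPf ->; rewrite mulr0n mul0r.
rewrite (bigD1 (lift ord0 i)) //= /bump leq0n add1n eqxx big1 ?addr0 // => k.
by rewrite -val_eqE /= /bump leq0n add1n => /negPf ->; rewrite mulr0n mul0r.
Qed.

Lemma bidiagBZ xi (v w : nat -> A) (a : A) :
  bidiag xi v - a *: bidiag xi w = bidiag xi (fun k => v k - a * w k).
Proof.
apply/matrixP=> i k; rewrite !mxE.
by do 2!case: (_ == _); rewrite ?mulr0n ?mulr1n; ring.
Qed.

End BidiagonalFactor.

Lemma map_bidiag (A B : comNzRingType) (f : {rmorphism A -> B}) n xi w :
  map_mx f (bidiag n xi w) = bidiag n (f \o xi) (f \o w).
Proof. by apply/matrixP=> i k; rewrite !mxE rmorphB !rmorphMn !rmorphM. Qed.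

Lemma map_shift_unity (A B : comNzRingType) (f : {rmorphism A -> B}) n :
  map_mx f (shift_unity A n) = shift_unity B n.
Proof.
apply/matrixP=> i k; rewrite !mxE.
by case: ifP => _; [case: ifP => _; rewrite ?rmorphN rmorph1 | rewrite rmorph_nat].
Qed.

Section Rank.
Variables (F : fieldType) (n : nat).

Lemma row_free_shift_unity : row_free (shift_unity F n).
Proof.
apply/inj_row_free => v /rowP vE0; pose l : 'I_n.+2 := ord_max.
(* Column 0 is zero except in the last row, so it isolates the last coordinate of [v]. Once that is
   zero, column [k.+1] isolates coordinate [k]. *)
have vl : v 0 l = 0.
  have := vE0 ord0; rewrite !mxE (bigD1 l) //= mxE eqxx mulr1 big1 ?addr0 // => k.
  by rewrite -val_eqE /= mxE => /negPf -> /=; rewrite mulr0.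
apply/rowP => k; rewrite [RHS]mxE; have [-> //|kl] := eqVneq k l.
have kn : (k.+1 < n.+2)%N by rewrite ltn_neqAle ltn_ord andbT eqSS.
have := vE0 (Ordinal kn); rewrite !mxE (bigD1 k) //= mxE /= eqxx.
rewrite (negPf kl : (k == n.+1 :> nat) = false) mulr1.
rewrite big1 ?addr0 // => i ik; have [-> |il] := eqVneq i l; first by rewrite vl mul0r.
rewrite mxE /= (negPf il : (i == n.+1 :> nat) = false) eqSS eq_sym.
by rewrite (negPf ik : (i == k :> nat) = false) mulr0.
Qed.

Lemma row_free_bidiag (xi w : nat -> F) :
    (forall k, (k < n.+2)%N -> xi k != 0) ->
    (forall k l, (k < n.+2)%N -> (l < n.+2)%N -> w k = 0 -> w l = 0 -> k = l) ->
  row_free (bidiag n xi w).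
Proof.
move=> xi0 w1; apply/inj_row_free => u /rowP uB0.
(* At most one term survives, and none when [k] is 0 or [n.+2]: the sum builds in the extension by
   zero. *)
pose y k := \sum_(i < n.+1) u 0 i * xi i * xi i.+1 *+ (i.+1 == k).
have wD (k : 'I_n.+2) : w k * (y k.+1 - y k) = 0.
  (* Column [k] meets only rows [k] and [k - 1], both with the factor [w k]; multiplying by [xi k]
     completes the products in [y]. *)
  transitivity (xi k * (u *m bidiag n xi w) 0 k); last by rewrite uB0 mxE mulr0.
  rewrite mxE mulr_sumr -sumrB mulr_sumr; apply: eq_bigr => i _; rewrite mxE eqSS.
  have [ik|_] := eqVneq (nat_of_ord i) k.
    by rewrite ik (gtn_eqF (ltnSn _)) (ltn_eqF (ltnSn _)) ?mulr0n ?mulr1n; ring.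
  have [ik|_] := eqVneq i.+1 k; rewrite ?mulr0n ?mulr1n; last by ring.
  by rewrite ik; ring.
have y0 : y 0%N = 0 by apply: big1.
have yn : y n.+2 = 0.
  by apply: big1 => i _; rewrite eqSS (ltn_eqF (ltn_ord i)).
have D0 (k : 'I_n.+2) : y k.+1 - y k = 0.
  have [wk0|wk0] := eqVneq (w k) 0; last first.
    by move/eqP: (wD k); rewrite mulf_eq0 (negPf wk0) => /eqP.
  (* At the exceptional index, the telescoping sum leaves only this difference, since [w] is nonzero
     at all others. *)
  have : \sum_(j < n.+2) (y j.+1 - y j) = 0.
    by rewrite -(big_mkord xpredT (fun j => y j.+1 - y j)) telescope_sumr // y0 yn subr0.
  rewrite (bigD1 k) //= big1 ?addr0 // => j jk; apply/eqP.
  move/eqP: (wD j); rewrite mulf_eq0 => /orP[/eqP wj0|//].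
  by case/eqP: jk; apply: val_inj; apply: w1; rewrite ?ltn_ord.
have y_eq0 k : (k <= n.+2)%N -> y k = 0.
  elim: k => // k IH kn.
  by move/eqP: (D0 (Ordinal kn)); rewrite /= IH ?subr0 ?(ltnW kn) // => /eqP.
apply/rowP => i; rewrite [RHS]mxE; have := y_eq0 i.+1 (ltnW (ltn_ord _)).
rewrite /y (bigD1 i) //= eqxx big1 ?addr0 => [|k /negPf ki]; last first.
  by rewrite eqSS val_eqE ki.
move/eqP; rewrite mulr1n !mulf_eq0.
have /negPf -> := xi0 i (ltnW (ltn_ord (lift ord0 i))).
have /negPf -> := xi0 i.+1 (ltn_ord (lift ord0 i)).
by rewrite !orbF => /eqP.
Qed.

End Rank.

Section Barycentric.
Variables (F : fieldType) (d : nat) (sigma xi : d.-tuple F).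
Hypothesis sigma_uniq : uniq sigma.
Hypothesis xi_neq0 : forall j : 'I_d, tnth xi j != 0.

Let w k : ratfun F := ('X - (sigma`_k)%:P)%:F.
Let c k : ratfun F := (xi`_k)%:P%:F.

Lemma tofrac_XsubC_neq0 k : w k != 0.
Proof. by rewrite tofrac_eq0 polyXsubC_eq0. Qed.

(* Clear denominators and evaluate at [sigma_0]. *)
Lemma baryc_denom_neq0 : (0 < d)%N -> \sum_(i < d) c i / w i != 0.
Proof.
move=> d0; pose o := Ordinal d0.
pose p := \sum_(i < d) xi`_i *: \prod_(j < d | j != i) ('X - (sigma`_j)%:P).
have pE : p%:F = (\sum_(i < d) c i / w i) * \prod_(j < d) w j.
  rewrite mulr_suml rmorph_sum; apply: eq_bigr => i _ /=.
  rewrite -mul_polyC rmorphM rmorph_prod [in RHS](bigD1 i) //= mulrA.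
  by rewrite divfK ?tofrac_XsubC_neq0.
suff : p != 0.
  by rewrite -(tofrac_eq0 p) pE; apply: contraNneq => ->; rewrite mul0r.
suff : p.[sigma`_0%N] != 0 by apply: contraNneq => ->; rewrite horner0.
rewrite horner_sum (bigD1 o) //= [X in _ + X]big1 ?addr0 => [|i io].
  rewrite hornerZ mulf_neq0 //; first by rewrite -(tnth_nth 0 xi o).
  rewrite horner_prod; apply/prodf_neq0 => j jo.
  by rewrite hornerXsubC subr_eq0 nth_uniq ?size_tuple // eq_sym.
rewrite hornerZ (bigD1 o) 1?eq_sym //= hornerM hornerXsubC subrr mul0r.
exact: mulr0.
Qed.

(** Cancelling [w k] on the left and [w l] on the right leaves [c k * c l] over the common
    denominator. *)
Lemma baryc_exchange (k l : nat) :
  c l * w k * baryc sigma xi k = c k * w l * baryc sigma xi l.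
Proof.
rewrite /baryc -/(w k) -/(w l) -/(c k) -/(c l).
rewrite !mulrA; congr (_ / _).
rewrite (mulrAC _ _ (c k)) (mulrAC _ _ (c l)) !mulfK ?tofrac_XsubC_neq0 //.
exact: mulrC.
Qed.

Lemma sum_baryc : (0 < d)%N -> \sum_(i < d) baryc sigma xi i = 1.
Proof. by move=> d0; rewrite -mulr_suml divff ?baryc_denom_neq0. Qed.

End Barycentric.

Lemma shift_unity_baryc_vec (F : fieldType) n (sigma xi : n.+2.-tuple F) :
    uniq sigma -> (forall j, tnth xi j != 0) ->
  shift_unity (ratfun F) n *m baryc_vec sigma xi = \col_k baryc sigma xi k.
Proof.
move=> sigma_uniq xi0; apply/colP => k; rewrite !mxE.
(* Only the last row uses that the functions sum to 1; every other row just selects an entry. *)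
have [kn|kn] := eqVneq (nat_of_ord k) n.+1.
  rewrite big_ord_recl !mxE kn eqxx /= mulr1.
  under eq_bigr => j _ do rewrite !mxE kn eqxx /= mulN1r.
  rewrite sumrN -(sum_baryc sigma_uniq xi0) // big_ord_recr /= addrAC.
  by rewrite -[RHS]add0r; congr (_ + _); apply/subrr.
have k1n : (k.+1 < n.+2)%N by rewrite ltn_neqAle ltn_ord andbT eqSS.
rewrite (bigD1 (Ordinal k1n)) //= !mxE (negPf kn) eqxx mul1r big1 ?addr0 // => j.
by rewrite -val_eqE /= !mxE (negPf kn) => /negPf ->; rewrite mul0r.
Qed.

(** The minus sign in [M - s N] forces [w = -1] in [N]: [- sigma k - s * (-1) = s - sigma k]. *)
Lemma pencil_bidiag (F : fieldType) n (xi sigma : nat -> F) m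
    (X : 'M[F]_(n.+2, m)) :
  pencil (bidiag n xi (fun k => - sigma k) *m X) (bidiag n xi (fun=> -1) *m X)
  = bidiag n (polyC \o xi) (fun k => 'X - (sigma k)%:P) *m map_mx polyC X.
Proof.
rewrite /pencil !map_mxM !map_bidiag scalemxAl -mulmxBl bidiagBZ.
congr (_ *m _); apply/matrixP => i k; rewrite !mxE /=.
by rewrite !rmorphN rmorph1; do 2!case: (_ == _); rewrite ?mulr0n ?mulr1n; ring.
Qed.

(** Stating [o = ord0] as an equation allows any bound proof inside the ordinal. *)
Lemma row'_baryc_pencil (F : fieldType) n (sigma xi : n.+2.-tuple F)
    (r : ratfun F) (o : 'I_n.+2) : o = ord0 ->
  row' o (baryc_pencil sigma xi r) =
  bidiag n (polyC \o nth 0 xi) (fun k => 'X - (sigma`_k)%:P)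
    *m shift_unity {poly F} n.
Proof.
move=> ->; apply/matrixP => i j; rewrite mul_bidiag !mxE lift0 /= eqSS.
rewrite (ltn_eqF (ltn_ord i)) -!mul_polyC.
(* Only row [n] reaches the last row of [shift_unity], which fills all its columns. *)
have [->|ni] := eqVneq (nat_of_ord i) n.
  have [->|j0] := eqVneq (nat_of_ord j) 0%N; first by rewrite /=; ring.
  by case: eqVneq => _ /=; ring.
have [->|ji] := eqVneq (nat_of_ord j) i.+1.
  by rewrite (ltn_eqF (ltnSn _)) /=; ring.
by case: eqVneq => _ /=; ring.
Qed.

Theorem lemma2 (R : realType) (d : nat) (hd : (2 <= d)%N)
    (sigma xi : d.-tuple R[i])
    (hsigma : uniq sigma)
    (hxi : forall j : 'I_d, tnth xi j != 0)
    (r : ratfun R[i])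
    (hr : r = \sum_(j < d) (rateval r sigma`_j)%:P%:F * baryc sigma xi j) :
  exists M N : 'M[R[i]]_(d.-1, d),
    row' (Ordinal (ltnW hd)) (baryc_pencil sigma xi r) = pencil M N /\
    full_rank_dual_linear_basis M N (baryc_vec sigma xi).
Proof.
case: d hd sigma xi hsigma hxi r hr => [|[|n]] // hd sigma xi hsigma hxi r _.
have xi0 k : (k < n.+2)%N -> xi`_k != 0.
  by move=> kn; rewrite -(tnth_nth 0 xi (Ordinal kn)).
have rankE w :
    (forall k l, (k < n.+2)%N -> (l < n.+2)%N -> w k = 0 -> w l = 0 -> k = l) ->
    \rank (bidiag n (nth 0 xi) w *m shift_unity _ n) = n.+1.
  move=> w1; rewrite mxrankMfree ?row_free_shift_unity //.
  by apply/eqP; apply: row_free_bidiag.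
pose M := bidiag n (nth 0 xi) (fun k => - sigma`_k) *m shift_unity _ n.
pose N := bidiag n (nth 0 xi) (fun=> -1) *m shift_unity _ n.
have MNE : pencil M N = bidiag n (polyC \o nth 0 xi) (fun k => 'X - (sigma`_k)%:P)
    *m shift_unity _ n by rewrite pencil_bidiag map_shift_unity.
exists M, N; split; first by rewrite MNE row'_baryc_pencil //; apply/val_inj.
split=> [|s|].
- rewrite /dual_linear_basis MNE map_mxM map_bidiag map_shift_unity -mulmxA.
  rewrite shift_unity_baryc_vec //; apply/colP => i.
  (* Row [i] is the exchange identity between [i] and [i.+1]. *)
  by rewrite mul_bidiag !mxE lift0 /= baryc_exchange subrr.
(* Here [w k = s - sigma_k], and distinct support points allow at most one zero. *)
- rewrite scalemxAl -mulmxBl bidiagBZ rankE // => k l kn ln /=.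
  rewrite mulrN1 opprK ![_ + s]addrC => /eqP; rewrite subr_eq0 => /eqP -> /eqP.
  by rewrite subr_eq0 nth_uniq ?size_tuple // => /eqP.
- by apply: rankE => k l _ _ /eqP; rewrite oppr_eq0 oner_eq0.
Qed.
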